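(* Let $\overline{A_0A_1A_2A_3}$ be a tetrahedron in $\mathbb{A}^3$ that is $B$-tri-rectangular at $A_0$, with all four $B$-quadreas $\mathcal{A}_{012},\mathcal{A}_{013},\mathcal{A}_{023},\mathcal{A}_{123}$ nonzero. Then its $B$-dihedral spreads satisfy $$E_{12}+E_{13}+E_{23}=2.$$
   Context: Let $\mathbb{F}$ be a field of characteristic not $2$, $\mathbb{V}^3=\mathbb{F}^3$ the space of row vectors, and $\mathbb{A}^3$ the three-dimensional affine space over $\mathbb{F}$ with associated vector space $\mathbb{V}^3$; $\overrightarrow{XY}=Y-X$ for points $X,Y$. Let $B$ be a symmetric invertible $3\times3$ matrix over $\mathbb{F}$. Define $v\cdot_B w=vBw^T$ and $Q_B(v)=v\cdot_B v$. A tetrahedron $\overline{A_0A_1A_2A_3}$ is a collection of four points of $\mathbb{A}^3$. Put $Q_{ij}=Q_B(\overrightarrow{A_iA_j})$ (symmetric in $i,j$). The $B$-quadreas are $\mathcal{A}_{ijk}=A(Q_{ij},Q_{ik},Q_{jk})$ with $A(a,b,c)=(a+b+c)^2-2(a^2+b^2+c^2)$. The tetrahedron is $B$-tri-rectangular at $A_0$ if the vectors $v_i=\overrightarrow{A_0A_i}$ ($i=1,2,3$) are mutually $B$-perpendicular: $v_1\cdot_B v_2=v_1\cdot_B v_3=v_2\cdot_B v_3=0$. A $B$-normal vector of a plane is a nonzero vector $n$ with $\overrightarrow{XY}\cdot_B n=0$ for all points $X,Y$ of the plane. The $B$-dihedral spread between two planes with $B$-normal vectors $n_1,n_2$ (with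 $Q_B(n_1),Q_B(n_2)\neq0$) is $1-\frac{(n_1\cdot_B n_2)^2}{Q_B(n_1)Q_B(n_2)}$. For $\{i,j,k,l\}=\{0,1,2,3\}$ with $i<j$, $E_{ij}$ denotes the $B$-dihedral spread between the planes $A_iA_jA_k$ and $A_iA_jA_l$ (planes through the indicated points). When the four $B$-quadreas are nonzero, each triple of points is non-collinear and each plane of the tetrahedron has non-null $B$-normal vectors, so all $E_{ij}$ are defined. *)

(* Defs.v *)
(* Points of affine 3-space over F are modelled by row vectors. *)
From mathcomp Require Export all_boot all_algebra.
From mathcomp Require Export boolp classical_sets.

Set Implicit Arguments.
Unset Strict Implicit.
Unset Printing Implicit Defensive.
Import GRing.Theory.
Local Open Scope ring_scope.
Local Open Scope classical_set_scope.

Definition vec (F : fieldType) (X Y : 'rV[F]_3) : 'rV[F]_3 := Y - X.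

Definition Bdot (F : fieldType) (B : 'M[F]_3) (v w : 'rV[F]_3) : F :=
  (v *m B *m w^T) 0 0.

Definition Bquad (F : fieldType) (B : 'M[F]_3) (v : 'rV[F]_3) : F :=
  Bdot B v v.

Definition archimedes (F : fieldType) (a b c : F) : F :=
  (a + b + c) ^+ 2 - 2 * (a ^+ 2 + b ^+ 2 + c ^+ 2).

Definition quadrea (F : fieldType) (B : 'M[F]_3) (X Y Z : 'rV[F]_3) : F :=
  archimedes (Bquad B (vec X Y)) (Bquad B (vec X Z)) (Bquad B (vec Y Z)).

Definition tri_rectangular (F : fieldType) (B : 'M[F]_3)
    (A0 A1 A2 A3 : 'rV[F]_3) : Prop :=
  [/\ Bdot B (vec A0 A1) (vec A0 A2) = 0,
      Bdot B (vec A0 A1) (vec A0 A3) = 0 &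
      Bdot B (vec A0 A2) (vec A0 A3) = 0].

(* This is a genuine plane only when X, Y, Z are not collinear. *)
Definition plane (F : fieldType) (X Y Z : 'rV[F]_3) : set 'rV[F]_3 :=
  [set P | exists s t : F, vec X P = s *: vec X Y + t *: vec X Z].

Definition Bnormal (F : fieldType) (B : 'M[F]_3) (Pi : set 'rV[F]_3)
    (n : 'rV[F]_3) : Prop :=
  n != 0 /\ forall X Y, Pi X -> Pi Y -> Bdot B (vec X Y) n = 0.

Definition spread_of_normals (F : fieldType) (B : 'M[F]_3)
    (n1 n2 : 'rV[F]_3) : F :=
  1 - Bdot B n1 n2 ^+ 2 / (Bquad B n1 * Bquad B n2).

(* The common value of [spread_of_normals] over all non-null normals of the two
   planes, and 0 when one of them has no such normal.  For genuine planes and B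
   invertible the choice of normals is irrelevant: see [dihedral_spreadE]. *)
Definition dihedral_spread (F : fieldType) (B : 'M[F]_3)
    (Pi1 Pi2 : set 'rV[F]_3) : F :=
  xget 0 [set E | exists n1 n2 : 'rV[F]_3,
    [/\ Bnormal B Pi1 n1, Bnormal B Pi2 n2,
        Bquad B n1 != 0, Bquad B n2 != 0 & E = spread_of_normals B n1 n2]].

(* The spread E_ij along the edge XY of the tetrahedron with vertices X, Y, Z, W. *)
Definition edge_spread (F : fieldType) (B : 'M[F]_3)
    (X Y Z W : 'rV[F]_3) : F :=
  dihedral_spread B (plane X Y Z) (plane X Y W).

Lemma Bnormal_plane_unique (F : fieldType) (B : 'M[F]_3)
    (X Y Z n n' : 'rV[F]_3) :
  B \in unitmx -> row_free (col_mx (vec X Y) (vec X Z)) ->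
  Bnormal B (plane X Y Z) n -> Bnormal B (plane X Y Z) n' ->
  exists2 c, c != 0 & n' = c *: n.
Proof.
move=> uB fr [n0 Hn] [n'0 Hn'].
set M := col_mx _ _ in fr.
have pX : plane X Y Z X by exists 0, 0; rewrite /vec subrr !scale0r addr0.
have pY : plane X Y Z Y by exists 1, 0; rewrite scale1r scale0r addr0.
have pZ : plane X Y Z Z by exists 0, 1; rewrite scale1r scale0r add0r.
have orth m : (forall P Q, plane X Y Z P -> plane X Y Z Q ->
    Bdot B (vec P Q) m = 0) -> (m <= kermx (B^T *m M^T))%MS.
  move=> Hm; apply/sub_kermxP; apply: trmx_inj.
  rewrite !trmx_mul !trmxK trmx0 /M !mul_col_mx.
  have z v : Bdot B v m = 0 -> v *m B *m m^T = 0.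
    by move=> h; apply/matrixP => i j; rewrite !ord1 [RHS]mxE.
  by rewrite !z ?col_mx0 //; exact: Hm.
have rk : \rank (kermx (B^T *m M^T)) = 1%N.
  rewrite mxrank_ker -mxrank_tr trmx_mul !trmxK mxrankMfree ?row_free_unit //.
  by rewrite (eqP fr).
have sn : (kermx (B^T *m M^T) <= n)%MS.
  by rewrite -(mxrank_leqif_sup (orth _ Hn)) rk rank_rV n0.
have /sub_rVP[c ec] := submx_trans (orth _ Hn') sn.
exists c => //; apply: contraNneq n'0 => c0.
by rewrite ec c0 scale0r.
Qed.

Lemma dihedral_spreadE (F : fieldType) (B : 'M[F]_3)
    (X Y Z X' Y' Z' n1 n2 : 'rV[F]_3) :
  B \in unitmx ->
  row_free (col_mx (vec X Y) (vec X Z)) ->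
  row_free (col_mx (vec X' Y') (vec X' Z')) ->
  Bnormal B (plane X Y Z) n1 -> Bnormal B (plane X' Y' Z') n2 ->
  Bquad B n1 != 0 -> Bquad B n2 != 0 ->
  dihedral_spread B (plane X Y Z) (plane X' Y' Z') = spread_of_normals B n1 n2.
Proof.
move=> uB fr fr' N1 N2 q1 q2; rewrite /dihedral_spread.
case: xgetP => [E _ [m1 [m2 [M1 M2 _ _ ->]]]|/(_ (spread_of_normals B n1 n2))].
  have [c c0 ->] := Bnormal_plane_unique uB fr N1 M1.
  have [d d0 ->] := Bnormal_plane_unique uB fr' N2 M2.
  have sc a b v w : Bdot B (a *: v) (b *: w) = a * b * Bdot B v w.
    by rewrite /Bdot linearZ /= -!scalemxAl -scalemxAr scalerA mxE.
  rewrite /spread_of_normals /Bquad !sc exprMn.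
  have -> x y : c * c * x * (d * d * y) = (c * d) ^+ 2 * (x * y).
    by rewrite mulrACA expr2 [c * d * _]mulrACA.
  by rewrite -mulf_div divff ?mul1r // expf_neq0 // mulf_neq0.
by case; exists n1, n2.
Qed.

(* Main.v *)
Require Import Defs.
From mathcomp Require Import all_boot all_algebra.
From mathcomp Require Import ring.

Set Implicit Arguments.
Unset Strict Implicit.
Unset Printing Implicit Defensive.
Import GRing.Theory.
Local Open Scope ring_scope.

(** Write [u], [v], [w] for the three mutually perpendicular edges at the apex
    and [p], [q], [r] for their quadrances.  By Pythagoras each quadrea of a
    face through the apex is four times the product of the quadrances of its
    two edges, and the quadrea of the opposite face is the sum of these three
    ([quadrea_opposite], a form of de Gua's theorem), namely [4 * S] with
    [S = p * q + p * r + q * r].  So the hypotheses say exactly that [p], [q],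
    [r] and [S] are nonzero (and that 2 is).

    The planes through the apex have normals [u], [v], [w], and the opposite
    plane has the normal [n = (q * r) *: u + (p * r) *: v + (p * q) *: w], which
    has the same product [p * q * r] with each of the three edges and quadrance
    [p * q * r * S].  Hence the spread along the edge opposite to [w] is
    [1 - (p * q * r)^2 / (r * (p * q * r * S)) = 1 - p * q / S]
    ([edge_spread_opposite]), and the three fractions subtracted in this way
    add up to [S / S = 1]. *)

(** * Bilinear algebra *)

Section BilinearForm.
Variables (F : fieldType) (B : 'M[F]_3).
Implicit Types u v w n X Y Z O P Q R : 'rV[F]_3.

Lemma BdotDl u v w : Bdot B (u + v) w = Bdot B u w + Bdot B v w.
Proof. by rewrite /Bdot !mulmxDl mxE. Qed.

Lemma BdotDr u v w : Bdot B u (v + w) = Bdot B u v + Bdot B u w.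
Proof. by rewrite /Bdot linearD mulmxDr mxE. Qed.

Lemma BdotZl a u v : Bdot B (a *: u) v = a * Bdot B u v.
Proof. by rewrite /Bdot -!scalemxAl mxE. Qed.

Lemma BdotZr a u v : Bdot B u (a *: v) = a * Bdot B u v.
Proof. by rewrite /Bdot linearZ /= -scalemxAr mxE. Qed.

Lemma BdotNl u v : Bdot B (- u) v = - Bdot B u v.
Proof. by rewrite -scaleN1r BdotZl mulN1r. Qed.

Lemma BdotNr u v : Bdot B u (- v) = - Bdot B u v.
Proof. by rewrite -scaleN1r BdotZr mulN1r. Qed.

Lemma Bdot0l v : Bdot B 0 v = 0.
Proof. by rewrite -(scale0r 0) BdotZl mul0r. Qed.

Definition BdotE := (BdotDl, BdotDr, BdotNl, BdotNr, BdotZl, BdotZr).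

Lemma BdotC u v : B^T = B -> Bdot B u v = Bdot B v u.
Proof.
move=> B_sym; rewrite /Bdot -[in LHS]B_sym -[u in LHS]trmxK.
by rewrite -!trmx_mul mulmxA [LHS]mxE.
Qed.

Lemma vec_sub O X Y : vec X Y = vec O Y - vec O X.
Proof. by rewrite /vec opprB addrA subrK. Qed.

Lemma vec_opp X Y : vec X Y = - vec Y X.
Proof. by rewrite /vec opprB. Qed.

(** The two vectors pair with [x] and [y] in a triangular matrix with nonzero
    diagonal, so no nontrivial combination of them can vanish. *)
Lemma row_free_triangular u v x y :
  Bdot B u x != 0 -> Bdot B v x = 0 -> Bdot B v y != 0 ->
  row_free (col_mx u v).
Proof.
move=> ux vx vy; apply: inj_row_free => c.
rewrite -[c]hsubmxK mul_row_col [lsubmx c]mx11_scalar [rsubmx c]mx11_scalar.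
rewrite !mul_scalar_mx; set a := lsubmx c 0 0; set b := rsubmx c 0 0 => comb0.
have pair0 z : a * Bdot B u z + b * Bdot B v z = 0.
  by rewrite -!BdotZl -BdotDl comb0 Bdot0l.
have a0 : a = 0.
  have /eqP := pair0 x.
  by rewrite vx mulr0 addr0 mulf_eq0 (negPf ux) orbF => /eqP.
have b0 : b = 0.
  have /eqP := pair0 y.
  by rewrite a0 mul0r add0r mulf_eq0 (negPf vy) orbF => /eqP.
by rewrite a0 b0 raddf0 row_mx0.
Qed.

Lemma Bnormal_plane X Y Z n :
  Bquad B n != 0 -> Bdot B (vec X Y) n = 0 -> Bdot B (vec X Z) n = 0 ->
  Bnormal B (plane X Y Z) n.
Proof.
move=> qn XYn XZn; split.
  by apply: contraNneq qn => ->; rewrite /Bquad Bdot0l.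
have XPn P : plane X Y Z P -> Bdot B (vec X P) n = 0.
  by case=> s [t ->]; rewrite BdotDl !BdotZl XYn XZn !mulr0 addr0.
by move=> P Q /XPn XP /XPn XQ; rewrite (vec_sub X) BdotDl BdotNl XP XQ subrr.
Qed.

(** * Quadreas of a tri-rectangular tetrahedron *)

Hypothesis B_sym : B^T = B.

Lemma Pythagoras O P Q : Bdot B (vec O P) (vec O Q) = 0 ->
  Bquad B (vec P Q) = Bquad B (vec O P) + Bquad B (vec O Q).
Proof.
rewrite (vec_sub O P Q); move: (vec O P) (vec O Q) => u v uv0.
by rewrite /Bquad !BdotE (BdotC v u) // uv0; ring.
Qed.

Lemma quadrea_right_angle O P Q : Bdot B (vec O P) (vec O Q) = 0 ->
  quadrea B O P Q = 4 * (Bquad B (vec O P) * Bquad B (vec O Q)).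
Proof. by move=> PQ0; rewrite /quadrea (Pythagoras PQ0) /archimedes; ring. Qed.

Lemma quadrea_opposite O P Q R : tri_rectangular B O P Q R ->
  let p := Bquad B (vec O P) in
  let q := Bquad B (vec O Q) in
  let r := Bquad B (vec O R) in
  quadrea B P Q R = 4 * (p * q + p * r + q * r).
Proof.
case=> PQ0 PR0 QR0 /=; rewrite /quadrea.
rewrite (Pythagoras PQ0) (Pythagoras PR0) (Pythagoras QR0) /archimedes; ring.
Qed.

(** * Spreads along the edges not through the apex *)

(** The plane of the face [P Q O] has the third edge [vec O R] as normal. A
    normal of [P Q R] has equal products with all three edges at [O], and [n]
    solves these equations without denominators. *)
Lemma edge_spread_opposite O P Q R : B \in unitmx ->
  tri_rectangular B O P Q R ->
  let p := Bquad B (vec O P) in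
  let q := Bquad B (vec O Q) in
  let r := Bquad B (vec O R) in
  let S := p * q + p * r + q * r in
  p != 0 -> q != 0 -> r != 0 -> S != 0 ->
  edge_spread B P Q O R = 1 - p * q / S.
Proof.
move=> B_inv [] /=.
(* [BdotE] would see an edge vector as a difference of points, so the edges at
   [O] become variables. *)
move: (vec_sub O P Q) (vec_sub O P R) (vec_opp P O).
move: (vec O P) (vec O Q) (vec O R) => u v w ePQ ePR ePO uv0 uw0 vw0.
have vu0 : Bdot B v u = 0 by rewrite BdotC.
have wu0 : Bdot B w u = 0 by rewrite BdotC.
have wv0 : Bdot B w v = 0 by rewrite BdotC.
move uu: (Bquad B u) => p; move vv: (Bquad B v) => q.
move ww: (Bquad B w) => r; set S := _ + q * r => p0 q0 r0 S0.
rewrite /Bquad in uu vv ww.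
have dotE := (BdotE, uu, vv, ww, uv0, uw0, vw0, vu0, wu0, wv0).
pose n := (q * r) *: u + (p * r) *: v + (p * q) *: w.
have wn : Bdot B w n = p * q * r by rewrite !dotE; ring.
have nn : Bquad B n = p * q * r * S.
  by rewrite /Bquad !dotE /S; ring.
have n0 : Bquad B n != 0 by rewrite nn !mulf_neq0.
have qw0 : Bquad B w != 0 by rewrite /Bquad ww.
have freeO : row_free (col_mx (vec P Q) (vec P O)).
  apply: (@row_free_triangular _ _ v u); rewrite ?ePQ ?ePO !dotE.
  - by rewrite oppr0 addr0.
  - by rewrite oppr0.
  - by rewrite oppr_eq0.
have freeR : row_free (col_mx (vec P Q) (vec P R)).
  apply: (@row_free_triangular _ _ v w); rewrite ?ePQ ?ePR !dotE ?oppr0 ?addr0 //.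
have normalO : Bnormal B (plane P Q O) w.
  by apply: Bnormal_plane => //; rewrite ?ePQ ?ePO !dotE; ring.
have normalR : Bnormal B (plane P Q R) n.
  by apply: Bnormal_plane => //; rewrite ?ePQ ?ePR !dotE; ring.
rewrite /edge_spread (dihedral_spreadE B_inv freeO freeR normalO normalR) //.
rewrite /spread_of_normals wn nn /Bquad ww; congr (1 - _).
by field; rewrite p0 q0 r0 S0.
Qed.

End BilinearForm.

Theorem theorem26 (F : fieldType) (B : 'M[F]_3) (A0 A1 A2 A3 : 'rV[F]_3)
    (charF : 2%N \notin [pchar F])
    (B_sym : B^T = B) (B_inv : B \in unitmx)
    (A_trirect : tri_rectangular B A0 A1 A2 A3)
    (q012 : quadrea B A0 A1 A2 != 0)
    (q013 : quadrea B A0 A1 A3 != 0)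
    (q023 : quadrea B A0 A2 A3 != 0)
    (q123 : quadrea B A1 A2 A3 != 0) :
  edge_spread B A1 A2 A0 A3 + edge_spread B A1 A3 A0 A2
    + edge_spread B A2 A3 A0 A1 = 2.
Proof.
have [d12 d13 d23] := A_trirect.
have tri132 : tri_rectangular B A0 A1 A3 A2 by split=> //; rewrite BdotC.
have tri231 : tri_rectangular B A0 A2 A3 A1 by split=> //; rewrite BdotC.
move: q012 q023 q123.
rewrite (quadrea_opposite B_sym A_trirect) /=.
rewrite (quadrea_right_angle B_sym d12) (quadrea_right_angle B_sym d23).
rewrite !mulf_eq0 !negb_or => /and3P[_ a1 a2] /and3P[_ _ a3] /andP[_ S0].
rewrite (edge_spread_opposite B_sym B_inv A_trirect) //.
set p := Bquad B (vec A0 A1) in a1 S0 *.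
set q := Bquad B (vec A0 A2) in a2 S0 *.
set r := Bquad B (vec A0 A3) in a3 S0 *.
have S132 : p * r + p * q + r * q = p * q + p * r + q * r by ring.
have S231 : q * r + q * p + r * p = p * q + p * r + q * r by ring.
rewrite (edge_spread_opposite B_sym B_inv tri132) -/p -/q -/r ?S132 //.
rewrite (edge_spread_opposite B_sym B_inv tri231) -/p -/q -/r ?S231 //.
by field.
Qed.
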